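(* Let $d\ge2$, let $H$ be a complex Hilbert space and let $A=(A_1,\dots,A_d)$ be a $d$-tuple of bounded linear operators on $H$ with $A_iA_j=A_jA_i$ for all $i,j$ and $\sum_{j=1}^d\Vert A_jh\Vert^2\le\Vert h\Vert^2$ for all $h\in H$. Let $N=\{n\in\mathbb{N}^d : A_1^{n_1}\cdots A_d^{n_d}=0\}$ and $X=\mathbb{N}^d\setminus N$. Then the compressed backward shift tuple $B^X=(B^X_1,\dots,B^X_d)$ on $\ell^2(X,\beta)$ satisfies the same hypotheses with the same vanishing set, namely: (i) $B^X_iB^X_j=B^X_jB^X_i$ for all $i,j=1,\dots,d$; (ii) $\sum_{j=1}^d\Vert B^X_jg\Vert^2\le\Vert g\Vert^2$ for all $g\in\ell^2(X,\beta)$; (iii) $\{n\in\mathbb{N}^d : (B^X_1)^{n_1}\cdots(B^X_d)^{n_d}=0\}=N$. (Consequently, the inequality $\Vert Q(A)\Vert\le\Vert Q(B^X)\Vert$, valid for every complex polynomial $Q$ in $d$ variables and every such tuple $A$ with vanishing set $N$, is optimal: it is attained by the tuple $A=B^X$.)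
   Context: $\mathbb{N}=\{0,1,2,\dots\}$; $e_1,\dots,e_d$ is the standard basis of $\mathbb{N}^d$. The zeroth power of an operator is the identity. For $n\in\mathbb{N}^d$ put $|n|=n_1+\dots+n_d$, $n!=n_1!\cdots n_d!$, $\beta(n)=|n|!/n!$. The space $\ell^2(\mathbb{N}^d,\beta)$ consists of $g:\mathbb{N}^d\to\mathbb{C}$ with $\Vert g\Vert^2=\sum_n|g(n)|^2\beta(n)<\infty$, and for $X\subseteq\mathbb{N}^d$, $\ell^2(X,\beta)$ is its closed subspace of functions supported in $X$. The backward shifts on $\ell^2(\mathbb{N}^d,\beta)$ are $B_jg(n)=g(n+e_j)$. $B_j^X=P_XB_j|_{\ell^2(X,\beta)}$, where $P_X$ is the orthogonal projection of $\ell^2(\mathbb{N}^d,\beta)$ onto $\ell^2(X,\beta)$. *)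

(* Defs.v *)
From HB Require Import structures.
From mathcomp Require Import all_boot all_order all_algebra sesquilinear.
From mathcomp Require Import complex.
(* The notations of [mpoly] clash with those of MathComp-Analysis: N^d is written
   [multinom d] ([mdeg n] is |n|, [mnm_add] is the addition, [mnm1 j] is e_j)
   and the ring of polynomials in d variables [mpoly d R]. *)
From mathcomp Require Import -(notations) mpoly.
From mathcomp Require Import all_classical all_reals all_analysis.
From mathcomp Require Import ring lra.

Set Implicit Arguments.
Unset Strict Implicit.
Unset Printing Implicit Defensive.

Import Order.TTheory GRing.Theory Num.Theory.
Import numFieldNormedType.Exports.
Import Normc.

Local Open Scope classical_set_scope.
Local Open Scope ring_scope.
Local Open Scope complex_scope.

Section Summation.
Variables (R : realType) (d : nat).
Local Notation T := (multinom d).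
Implicit Types (a b : T -> R) (u v : T -> R[i]).

(* Series over N^d are summed by increasing total degree; all series below are
   absolutely convergent, so the order of summation is immaterial. The indices
   [bmultinom d k] are the multi-indices n with |n| < k. *)
Definition psum a (k : nat) : R := \sum_(n : bmultinom d k) a n.

Definition rsum a : R := limn (psum a).

Definition csum u : R[i] :=
  rsum (fun n => complex.Re (u n)) +i* rsum (fun n => complex.Im (u n)).

Definition abs_bounded a :=
  exists M : R, forall k, psum (fun n => `|a n|) k <= M.

Let idx k : seq T := [seq val n | n <- enum {: bmultinom d k}].

Lemma psumE a k : psum a k = \sum_(n <- idx k) a n.
Proof. by rewrite /psum /idx big_map big_enum. Qed.

Lemma idx_uniq k : uniq (idx k).
Proof. by rewrite map_inj_uniq ?enum_uniq//; exact: val_inj. Qed.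

Lemma mem_idx k n : (n \in idx k) = (mdeg n < k)%N.
Proof.
apply/mapP/idP => [[m _ ->]|nk]; first by case: m.
by exists (BMultinom nk) => //; rewrite mem_enum.
Qed.

Lemma ler_sum_uniq (s t : seq T) a : uniq s -> uniq t -> {subset s <= t} ->
  (forall n, 0 <= a n) -> \sum_(n <- s) a n <= \sum_(n <- t) a n.
Proof.
move=> us ut st a0; rewrite [leRHS](bigID (fun n => n \in s))/=.
have e : \sum_(n <- t | n \in s) a n = \sum_(n <- s) a n.
  rewrite -big_filter; apply: perm_big; apply: uniq_perm; rewrite ?filter_uniq// => n.
  by rewrite mem_filter; case: (boolP (n \in s)) => // /st.
by rewrite e lerDl sumr_ge0.
Qed.

Lemma psum_nd a : (forall n, 0 <= a n) -> nondecreasing_seq (psum a).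
Proof.
move=> a0; apply/nondecreasing_seqP => k; rewrite !psumE.
apply: ler_sum_uniq => //; rewrite ?idx_uniq// => n; rewrite !mem_idx => nk.
exact: ltnW.
Qed.

Lemma psumD a b k : psum (fun n => a n + b n) k = psum a k + psum b k.
Proof. by rewrite /psum big_split. Qed.

Lemma psumZ c a k : psum (fun n => c * a n) k = c * psum a k.
Proof. by rewrite /psum mulr_sumr. Qed.

Lemma ler_psum a b k : (forall n, a n <= b n) -> psum a k <= psum b k.
Proof. by move=> ab; rewrite /psum ler_sum. Qed.

Lemma psum_ge0 a k : (forall n, 0 <= a n) -> 0 <= psum a k.
Proof. by move=> ab; rewrite /psum sumr_ge0. Qed.

Lemma abs_boundedP a M : (forall n, 0 <= a n) -> (forall k, psum a k <= M) ->
  abs_bounded a.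
Proof.
move=> a0 aM; exists M => k; apply: le_trans (aM k).
by apply: ler_psum => n; rewrite ger0_norm.
Qed.

Lemma abs_bounded_le a b : abs_bounded b -> (forall n, `|a n| <= b n) ->
  abs_bounded a.
Proof.
move=> [M bM] ab; exists M => k; apply: le_trans (bM k); apply: ler_psum => n.
by apply: le_trans (ab n) _; exact: ler_norm.
Qed.

Lemma abs_boundedD a b : abs_bounded a -> abs_bounded b ->
  abs_bounded (fun n => a n + b n).
Proof.
move=> [M aM] [N bN]; exists (M + N) => k.
apply: le_trans (lerD (aM k) (bN k)); rewrite -psumD; apply: ler_psum => n.
exact: ler_normD.
Qed.

Lemma abs_boundedZ c a : abs_bounded a -> abs_bounded (fun n => c * a n).
Proof.
move=> [M aM]; exists (`|c| * M) => k.
apply: le_trans (ler_wpM2l (normr_ge0 c) (aM k)).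
by rewrite -psumZ; apply: ler_psum => n; rewrite normrM.
Qed.

Lemma cvg_psum_ge0 a : (forall n, 0 <= a n) -> abs_bounded a -> cvgn (psum a).
Proof.
move=> a0 [M aM]; apply: nondecreasing_is_cvgn; first exact: psum_nd.
exists M => _ [k _ <-]; apply: le_trans (aM k); apply: ler_psum => n.
exact: ler_norm.
Qed.

Lemma cvg_psum a : abs_bounded a -> cvgn (psum a).
Proof.
move=> ab.
have h : abs_bounded (fun n => `|a n|).
  by case: ab => M aM; exists M => k;
    apply: le_trans (aM k); apply: ler_psum => n; rewrite normr_id.
have -> : psum a = psum (fun n => a n + `|a n|) \- psum (fun n => `|a n|).
  by apply/funext => k /=; rewrite psumD addrK.
apply: is_cvgB; apply: cvg_psum_ge0 => //.
  by move=> n; rewrite -lerBlDr sub0r lerNl -normrN ler_norm.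
exact: abs_boundedD.
Qed.

Lemma rsumD a b : abs_bounded a -> abs_bounded b ->
  rsum (fun n => a n + b n) = rsum a + rsum b.
Proof.
move=> ha hb; apply/cvg_lim => //.
have -> : psum (fun n => a n + b n) = psum a \+ psum b.
  by apply/funext => k; rewrite psumD.
by apply: cvgD; exact: cvg_psum.
Qed.

Lemma rsumZ c a : abs_bounded a -> rsum (fun n => c * a n) = c * rsum a.
Proof.
move=> ha; apply/cvg_lim => //.
have -> : psum (fun n => c * a n) = (fun k => c * psum a k).
  by apply/funext => k; rewrite psumZ.
by apply: cvgM; [exact: cvg_cst|exact: cvg_psum].
Qed.

Lemma rsum_ge a k : (forall n, 0 <= a n) -> abs_bounded a ->
  psum a k <= rsum a.
Proof.
by move=> a0 ha; apply: nondecreasing_cvgn_le; [exact: psum_nd|exact: cvg_psum].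
Qed.

Lemma rsum_le a M : (forall n, 0 <= a n) -> (forall k, psum a k <= M) ->
  rsum a <= M.
Proof.
move=> a0 aM; apply: limr_le; last by apply: nearW => k; exact: aM.
by apply: cvg_psum; exact: abs_boundedP aM.
Qed.

Lemma psum_term a n : (forall n, 0 <= a n) -> a n <= psum a (mdeg n).+1.
Proof.
move=> a0; rewrite psumE; apply: le_trans (_ : \sum_(m <- [:: n]) a m <= _).
  by rewrite big_seq1.
apply: ler_sum_uniq => //; first exact: idx_uniq.
by move=> m; rewrite inE => /eqP ->; rewrite mem_idx.
Qed.

Lemma le_esum_psum a k : (forall n, 0 <= a n) ->
  ((psum a k)%:E <= \esum_(n in setT) (a n)%:E)%E.
Proof.
move=> a0; apply: esum_ge; exists [set` idx k].
  by split => //; exact: finite_seq.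
by rewrite -fsbig_seq ?idx_uniq// psumE sumEFin.
Qed.

Lemma esum_psum_le a M : (forall n, 0 <= a n) -> (forall k, psum a k <= M) ->
  (\esum_(n in setT) (a n)%:E <= M%:E)%E.
Proof.
move=> a0 aM; apply: ge_ereal_sup => _ [F [fF _] <-].
rewrite fsbig_finite//= sumEFin lee_fin.
set s := (finmap.enum_fset _).
have [k sk] : exists k, {subset s <= idx k}.
  exists (\max_(n <- s) mdeg n).+1 => n ns.
  by rewrite mem_idx ltnS; exact: (@leq_bigmax_seq _ s xpredT (fun n => mdeg n) n ns).
apply: le_trans (aM k); rewrite psumE; apply: ler_sum_uniq => //.
  exact: finmap.fset_uniq.
exact: idx_uniq.
Qed.

Lemma esum_lty_bounded a : (forall n, 0 <= a n) ->
  (\esum_(n in setT) (a n)%:E < +oo)%E -> abs_bounded a.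
Proof.
move=> a0 aoo; apply: (@abs_boundedP a (fine (\esum_(n in setT) (a n)%:E))) => // k.
rewrite -lee_fin fineK; first exact: le_esum_psum.
by rewrite ge0_fin_numE//; apply: esum_ge0 => n _; rewrite lee_fin.
Qed.

Lemma bounded_esum_lty a : (forall n, 0 <= a n) -> abs_bounded a ->
  (\esum_(n in setT) (a n)%:E < +oo)%E.
Proof.
move=> a0 ha; apply: le_lt_trans (ltry (rsum a)).
by apply: esum_psum_le => // k; exact: rsum_ge.
Qed.

Lemma esum_rsum a : (forall n, 0 <= a n) -> abs_bounded a ->
  (\esum_(n in setT) (a n)%:E)%E = (rsum a)%:E.
Proof.
move=> a0 ha; apply/eqP; rewrite eq_le; apply/andP; split.
  by apply: esum_psum_le => // k; exact: rsum_ge.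
have fin : (\esum_(n in setT) (a n)%:E)%E \is a fin_num.
  rewrite ge0_fin_numE ?bounded_esum_lty//.
  by apply: esum_ge0 => n _; rewrite lee_fin.
rewrite -[leRHS]fineK// lee_fin; apply: rsum_le => // k.
by rewrite -lee_fin fineK//; exact: le_esum_psum.
Qed.


Lemma psum_reindex (h : T -> T) a k : injective h ->
  (forall n, (mdeg (h n) <= (mdeg n).+1)%N) -> (forall n, 0 <= a n) ->
  psum (a \o h) k <= psum a k.+1.
Proof.
move=> hi hd a0; rewrite !psumE -(big_map h xpredT a).
apply: ler_sum_uniq => //; [by rewrite (map_inj_uniq hi) idx_uniq|exact: idx_uniq|].
move=> _ /mapP[n + ->]; rewrite !mem_idx => nk.
exact: leq_ltn_trans (hd n) _.
Qed.

End Summation.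

Section SquareSummable.
Variables (R : realType) (d : nat).
Local Notation T := (multinom d).

Definition beta (n : T) : R := (mdeg n)`!%:R / (\prod_(i < d) (n i)`!)%:R.

Lemma beta_gt0 n : 0 < beta n.
Proof.
rewrite /beta divr_gt0// ltr0n ?fact_gt0// prodn_gt0// => i.
exact: fact_gt0.
Qed.

(* |g(n)|^2 beta(n) *)
Definition wsq (g : T -> R[i]) (n : T) : R := normc (g n) ^+ 2 * beta n.

Definition square_summable (g : T -> R[i]) : Prop :=
  (\esum_(n in [set: T]) (wsq g n)%:E < +oo)%E.

Lemma sqr_normcE (z : R[i]) :
  normc z ^+ 2 = complex.Re z ^+ 2 + complex.Im z ^+ 2.
Proof. by case: z => x y /=; rewrite sqr_sqrtr// addr_ge0 ?sqr_ge0. Qed.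

Lemma wsq_ge0 g n : 0 <= wsq g n.
Proof. by rewrite mulr_ge0 ?sqr_ge0// ltW// beta_gt0. Qed.

Lemma square_summableP g : square_summable g <-> abs_bounded (wsq g).
Proof.
split; [apply: esum_lty_bounded|apply: bounded_esum_lty] => n; exact: wsq_ge0.
Qed.

Lemma square_summableD f g : square_summable f -> square_summable g ->
  square_summable (f + g).
Proof.
move=> /square_summableP hf /square_summableP hg; apply/square_summableP.
apply: (abs_bounded_le (b := fun n => 2 * wsq f n + 2 * wsq g n)).
  by apply: abs_boundedD; exact: abs_boundedZ.
move=> n; rewrite ger0_norm ?wsq_ge0// /wsq ![2 * (_ * beta n)]mulrA -mulrDl.
apply: ler_wpM2r; first by rewrite ltW ?beta_gt0.
rewrite (_ : (f + g) n = f n + g n)// !sqr_normcE.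
case: (f n) (g n) => [a b] [a' b'] /=.
have := sqr_ge0 (a - a'); have := sqr_ge0 (b - b'); lra.
Qed.

Lemma square_summableZ c f : square_summable f -> square_summable (c *: f).
Proof.
move=> /square_summableP hf; apply/square_summableP.
have -> : wsq (c *: f) = (fun n => normc c ^+ 2 * wsq f n).
  by apply/funext => n; rewrite /wsq mulrA -exprMn -normcM.
exact: abs_boundedZ.
Qed.

Definition l2_pred (X : set T) : {pred T -> R[i]} :=
  fun g => `[< square_summable g /\ forall n, ~ X n -> g n = 0 >].

Lemma l2_pred_submod X : submod_closed (l2_pred X).
Proof.
split=> [|c f g].
  rewrite unfold_in; apply/asboolP; split => //.
  apply/square_summableP; exists 0 => k; rewrite le_eqVlt; apply/orP; left.
  apply/eqP; apply: big1 => n _.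
  by rewrite /wsq normc0 expr0n mul0r normr0.
rewrite !unfold_in => /asboolP[hf f0] /asboolP[hg g0]; apply/asboolP; split.
  by apply: square_summableD => //; exact: square_summableZ.
move=> n Xn; rewrite /GRing.add/= /GRing.scale/=.
by rewrite f0// g0// scaler0 addr0.
Qed.

HB.instance Definition _ X :=
  GRing.isSubmodClosed.Build R[i] (T -> R[i]) (l2_pred X) (l2_pred_submod X).

(* l^2(X, beta); the full space l^2(N^d, beta) is [l2 R [set: multinom d]]. *)
Record l2 (X : set T) := L2 { l2fun :> T -> R[i] ; _ : l2fun \in l2_pred X }.

HB.instance Definition _ X := [isSub for @l2fun X].
HB.instance Definition _ X := [Choice of l2 X by <:].
HB.instance Definition _ X := [SubChoice_isSubLmodule of l2 X by <:].

End SquareSummable.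

Section CSum.
Variables (R : realType) (d : nat).
Local Notation T := (multinom d).
Implicit Types u v : T -> R[i].

Definition csummable u := abs_bounded (fun n => complex.Re (u n)) /\
  abs_bounded (fun n => complex.Im (u n)).

Lemma csummableD u v : csummable u -> csummable v ->
  csummable (fun n => u n + v n).
Proof.
move=> [u1 u2] [v1 v2]; split.
  rewrite (_ : (fun _ => _) =
    (fun n => complex.Re (u n) + complex.Re (v n))); first exact: abs_boundedD.
  by apply/funext => n; case: (u n) (v n) => [? ?] [? ?].
rewrite (_ : (fun _ => _) =
  (fun n => complex.Im (u n) + complex.Im (v n))); first exact: abs_boundedD.
by apply/funext => n; case: (u n) (v n) => [? ?] [? ?].
Qed.

Lemma csumD u v : csummable u -> csummable v ->
  csum (fun n => u n + v n) = csum u + csum v.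
Proof.
move=> [u1 u2] [v1 v2]; rewrite /csum.
rewrite (_ : (fun n => complex.Re _) =
  (fun n => complex.Re (u n) + complex.Re (v n))); last first.
  by apply/funext => n; case: (u n) (v n) => [? ?] [? ?].
rewrite (_ : (fun n => complex.Im _) =
  (fun n => complex.Im (u n) + complex.Im (v n))); last first.
  by apply/funext => n; case: (u n) (v n) => [? ?] [? ?].
by rewrite !rsumD.
Qed.

Let ReM (c z : R[i]) : complex.Re (c * z) =
  complex.Re c * complex.Re z + - complex.Im c * complex.Im z.
Proof. by case: c z => [? ?] [? ?] /=; rewrite mulNr. Qed.

Let ImM (c z : R[i]) : complex.Im (c * z) =
  complex.Re c * complex.Im z + complex.Im c * complex.Re z.
Proof. by case: c z => [? ?] [? ?] /=. Qed.

Lemma csumZ c u : csummable u -> csum (fun n => c * u n) = c * csum u.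
Proof.
move=> [u1 u2]; apply/eqP; rewrite eq_complex ReM ImM /= -!rsumZ//.
rewrite -!rsumD ?abs_boundedZ//; try exact: abs_boundedZ.
by apply/andP; split; apply/eqP; congr rsum; apply/funext => n;
  rewrite (ReM, ImM).
Qed.

Lemma csummableZ c u : csummable u -> csummable (fun n => c * u n).
Proof.
move=> [u1 u2]; split; rewrite (funext (fun n => ReM _ _), funext (fun n => ImM _ _));
  by apply: abs_boundedD; exact: abs_boundedZ.
Qed.

Lemma csumJ u : csummable u -> csum (fun n => (u n)^*) = (csum u)^*.
Proof.
move=> [u1 u2]; rewrite /csum /=; congr Complex.
  by congr rsum; apply/funext => n; case: (u n).
rewrite -mulN1r -rsumZ//; congr rsum; apply/funext => n; rewrite mulN1r.
by case: (u n).
Qed.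

Lemma csum_eq0 u : (forall n, u n = 0) -> csum u = 0.
Proof.
move=> u0; have -> : u = (fun n => 0 * u n).
  by apply/funext => n; rewrite mul0r u0.
rewrite csumZ ?mul0r//; split; exists 0 => k; rewrite /psum big1// => n _;
  by rewrite u0 normr0.
Qed.

End CSum.

Section L2Dot.
Variables (R : realType) (d : nat).
Local Notation T := (multinom d).

(* The sum is absolutely convergent ([dot_csummable]); its diagonal is the
   squared norm by [l2_norm_dot] and [l2_norm_esum]. *)
Definition l2_dot (X : set T) (f g : l2 R X) : R[i] :=
  csum (fun n => f n * (g n)^* * (beta R n)%:C).

Definition l2_nsq (X : set T) (f : l2 R X) : R := rsum (wsq f).

Variable X : set T.
Implicit Types f g h : l2 R X.

Lemma l2_wsq f : abs_bounded (wsq f).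
Proof. by apply/square_summableP; case: f => f /= /asboolP[]. Qed.

Lemma l2_supp f n : ~ X n -> f n = 0.
Proof. by case: f => f /= /asboolP[_]; apply. Qed.

Lemma l2P f g : (forall n, f n = g n) -> f = g.
Proof. by move=> fg; apply/val_inj/funext. Qed.

Lemma l2_scaleaddE c f g n : (c *: f + g) n = c * f n + g n.
Proof. by []. Qed.

Lemma dot_csummable f g :
  csummable (fun n => f n * (g n)^* * (beta R n)%:C).
Proof.
have fgM := abs_boundedD (l2_wsq f) (l2_wsq g).
split; apply: abs_bounded_le fgM _ => n;
  rewrite /wsq !sqr_normcE -mulrDl; have b0 := ltW (beta_gt0 R n).
- case: (f n) (g n) => [a b] [a' b'] /=; rewrite !(mulr0, subr0).
  rewrite normrM (ger0_norm b0) ler_wpM2r// ler_norml.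
  have := sqr_ge0 (a - a'); have := sqr_ge0 (b - b').
  have := sqr_ge0 (a + a'); have := sqr_ge0 (b + b').
  by move=> *; apply/andP; split; nra.
- case: (f n) (g n) => [a b] [a' b'] /=; rewrite !(mulr0, add0r).
  rewrite normrM (ger0_norm b0) ler_wpM2r// ler_norml.
  have := sqr_ge0 (a - b'); have := sqr_ge0 (b - a').
  have := sqr_ge0 (a + b'); have := sqr_ge0 (b + a').
  by move=> *; apply/andP; split; nra.
Qed.

Lemma l2_dotC f g : l2_dot f g = (l2_dot g f)^*.
Proof.
rewrite /l2_dot -csumJ; last exact: dot_csummable.
congr csum; apply/funext => n.
rewrite !rmorphM; congr (_ * _); last by rewrite /= oppr0.
by rewrite mulrC; congr (_ * _); rewrite /= conjcK.
Qed.

Lemma l2_dotPl c f g h : l2_dot (c *: f + g) h = c * l2_dot f h + l2_dot g h.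
Proof.
rewrite /l2_dot -csumZ -?csumD; try exact: dot_csummable; last first.
  exact/csummableZ/dot_csummable.
congr csum; apply/funext => n; rewrite l2_scaleaddE.
by rewrite !mulrDl !mulrA.
Qed.

Lemma l2_dotff f : l2_dot f f = (l2_nsq f)%:C.
Proof.
apply/eqP; rewrite eq_complex /l2_dot /csum/=; apply/andP; split; apply/eqP.
  congr rsum; apply/funext => n; rewrite /wsq sqr_normcE.
  by case: (f n) => a b /=; ring.
rewrite (_ : (fun _ => _) = (fun n => 0 * wsq f n)).
  by rewrite rsumZ ?mul0r//; exact: l2_wsq.
by apply/funext => n; case: (f n) => a b /=; ring.
Qed.

Lemma l2_nsq_ge f n : wsq f n <= l2_nsq f.
Proof.
apply: le_trans (rsum_ge (mdeg n).+1 (wsq_ge0 f) (l2_wsq f)).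
by apply: psum_term; exact: wsq_ge0.
Qed.

Lemma l2_nsq_ge0 f : 0 <= l2_nsq f.
Proof. by apply: le_trans (l2_nsq_ge f mnm0); exact: wsq_ge0. Qed.

Lemma l2_nsq_eq0 f : l2_nsq f = 0 -> f = 0.
Proof.
move=> f0; apply: l2P => n; have := l2_nsq_ge f n; rewrite f0.
rewrite /wsq pmulr_lle0 ?beta_gt0// => h.
apply: eq0_normc; apply/eqP; rewrite -sqrf_eq0.
by rewrite eq_le h sqr_ge0.
Qed.

Lemma l2_dotBl f g h : l2_dot (f - g) h = l2_dot f h - l2_dot g h.
Proof.
have -> : f - g = (-1) *: g + f by rewrite scaleN1r addrC.
by rewrite l2_dotPl mulN1r addrC.
Qed.

Lemma l2_dotPr f c g h :
  l2_dot f (c *: g + h) = c^* * l2_dot f g + l2_dot f h.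
Proof.
rewrite l2_dotC l2_dotPl rmorphD rmorphM; congr (_ * _ + _).
  by rewrite [RHS]l2_dotC.
by rewrite [RHS]l2_dotC.
Qed.

HB.instance Definition _ := @bilinear_isBilinear.Build R[i] (l2 R X) (l2 R X)
  R[i] *%R (Num.conj \; *%R) (@l2_dot X)
  (fun g c f h => l2_dotPl c f h g, fun f c g h => l2_dotPr f c g h).

Lemma l2_dot_herm f g :
  l2_dot f g = (-1) ^+ false * Num.conj (l2_dot g f).
Proof. by rewrite expr0 mul1r l2_dotC. Qed.

HB.instance Definition _ := @isHermitianSesquilinear.Build R[i] (l2 R X)
  false Num.conj (@l2_dot X) l2_dot_herm.

Lemma l2_dot_gt0 f : f != 0 -> 0 < l2_dot f f.
Proof.
move=> f0; rewrite l2_dotff ltcR lt_neqAle l2_nsq_ge0 andbT eq_sym.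
by apply: contra f0 => /eqP /l2_nsq_eq0 ->.
Qed.

HB.instance Definition _ := @isDotProduct.Build R[i] (l2 R X) (@l2_dot X)
  l2_dot_gt0.

Lemma l2_nsqD f g :
  l2_nsq (f + g) = l2_nsq f + l2_nsq g + 2 * complex.Re (l2_dot f g).
Proof.
have e : l2_dot (f + g) (f + g) =
    l2_dot f f + l2_dot g g + (l2_dot f g + (l2_dot f g)^*).
  rewrite linearDl !linearDr /= (l2_dotC g f).
  by rewrite -!addrA; congr (_ + _); rewrite addrA addrC.
move: e; rewrite !l2_dotff => /(congr1 (@complex.Re R)) /= ->.
by case: (l2_dot f g) => a b /=; ring.
Qed.

Lemma l2_nsqZ (c : R[i]) f : l2_nsq (c *: f) = normc c ^+ 2 * l2_nsq f.
Proof.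
rewrite /l2_nsq -rsumZ; last exact: l2_wsq.
by congr rsum; apply/funext => n; rewrite /wsq [RHS]mulrA -exprMn -normcM.
Qed.

Lemma l2_CauchySchwarz f g :
  complex.Re (l2_dot f g) <= Num.sqrt (l2_nsq f) * Num.sqrt (l2_nsq g).
Proof.
set a := Num.sqrt (l2_nsq f); set b := Num.sqrt (l2_nsq g).
have ha : a ^+ 2 = l2_nsq f by rewrite sqr_sqrtr// l2_nsq_ge0.
have hb : b ^+ 2 = l2_nsq g by rewrite sqr_sqrtr// l2_nsq_ge0.
have a0 : 0 <= a by exact: sqrtr_ge0.
have b0 : 0 <= b by exact: sqrtr_ge0.
have [fe|fn] := eqVneq a 0.
  rewrite fe mul0r (_ : f = 0) ?linear0l//.
  by apply: l2_nsq_eq0; rewrite -ha fe expr0n.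
have [ge|gn] := eqVneq b 0.
  rewrite ge mulr0 (_ : g = 0) ?linear0r//.
  by apply: l2_nsq_eq0; rewrite -hb ge expr0n.
have ap : 0 < a by rewrite lt_neqAle eq_sym fn.
have bp : 0 < b by rewrite lt_neqAle eq_sym gn.
have := l2_nsq_ge0 (b%:C *: f + (- a)%:C *: g).
rewrite l2_nsqD !l2_nsqZ -ha -hb !sqr_normcE.
have -> : complex.Re (l2_dot (b%:C *: f) ((- a)%:C *: g)) =
    - (a * b) * complex.Re (l2_dot f g).
  rewrite linearZl_LR linearZr_LR /=.
  by case: (l2_dot f g) => x y /=; ring.
move=> /= h; rewrite -subr_ge0 -(pmulr_rge0 _ (mulr_gt0 ap bp)).
by lra.
Qed.

Lemma sqrt_l2_nsqD f g :
  Num.sqrt (l2_nsq (f + g)) <= Num.sqrt (l2_nsq f) + Num.sqrt (l2_nsq g).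
Proof.
have h : 0 <= Num.sqrt (l2_nsq f) + Num.sqrt (l2_nsq g).
  by rewrite addr_ge0 ?sqrtr_ge0.
rewrite -[leRHS]ger0_norm// -sqrtr_sqr ler_wsqrtr// l2_nsqD sqrrD.
rewrite !sqr_sqrtr ?l2_nsq_ge0//; have := l2_CauchySchwarz f g; lra.
Qed.

Definition l2_norm f : R[i] := (Num.sqrt (l2_nsq f))%:C.

Lemma l2_normD f g : l2_norm (f + g) <= l2_norm f + l2_norm g.
Proof. by rewrite /l2_norm -rmorphD lecR sqrt_l2_nsqD. Qed.

Lemma l2_normZ (c : R[i]) f : l2_norm (c *: f) = `|c| * l2_norm f.
Proof.
rewrite /l2_norm l2_nsqZ sqrtrM ?sqr_ge0// sqrtr_sqr.
rewrite ger0_norm ?rmorphM//.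
by case: c => a b /=; exact: sqrtr_ge0.
Qed.

Lemma l2_norm_eq0 f : l2_norm f = 0 -> f = 0.
Proof.
move=> [] /eqP; rewrite sqrtr_eq0 => h; apply: l2_nsq_eq0.
by apply/eqP; rewrite eq_le h l2_nsq_ge0.
Qed.

HB.instance Definition _ := @Lmodule_isNormed.Build R[i] (l2 R X)
  l2_norm l2_normD l2_normZ l2_norm_eq0.

Lemma l2_normE f : `|f| = (Num.sqrt (l2_nsq f))%:C.
Proof. by []. Qed.

End L2Dot.

Section L2Complete.
Variables (R : realType) (d : nat).
Local Notation T := (multinom d).
Variable X : set T.

Let gt0_complexE (e : R[i]) : 0 < e -> 0 < complex.Re e /\ e = (complex.Re e)%:C.
Proof. by case: e => a b; rewrite ltcE /= => /andP[/eqP -> ?]. Qed.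

Lemma l2_complete (F : set_system (l2 R X)) :
  ProperFilter F -> cauchy F -> cvg F.
Proof.
move=> FF Fc.
have key (e : R) : 0 < e ->
    exists f0 : l2 R X, F [set f | Num.sqrt (l2_nsq (f0 - f)) < e].
  move=> e0; move: Fc => /cauchyP.
  move=> /(_ e%:C); rewrite ltcR => /(_ e0) [f0 Ff0]; exists f0.
  apply: filterS Ff0 => f /=; rewrite -ball_normE /= l2_normE ltcR.
  by [].
have pt (f g : l2 R X) n : normc (f n - g n) <=
    Num.sqrt (l2_nsq (f - g)) / Num.sqrt (beta R n).
  rewrite ler_pdivlMr ?sqrtr_gt0 ?beta_gt0//.
  have n0 : 0 <= normc (f n - g n).
    by case: (f n - g n) => a b /=; exact: sqrtr_ge0.
  rewrite -[X in X * _]ger0_norm// -sqrtr_sqr -sqrtrM ?sqr_ge0//.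
  by rewrite ler_wsqrtr//; exact: (l2_nsq_ge (f - g) n).
have Re_normc (z : R[i]) : `|complex.Re z| <= normc z.
  by case: z => a b /=; rewrite -sqrtr_sqr ler_wsqrtr// lerDl sqr_ge0.
have Im_normc (z : R[i]) : `|complex.Im z| <= normc z.
  by case: z => a b /=; rewrite -sqrtr_sqr ler_wsqrtr// lerDr sqr_ge0.
have ptc n e : 0 < e -> exists f0 : l2 R X,
    F [set f | normc (f0 n - f n) < e].
  move=> e0; have s0 : 0 < Num.sqrt (beta R n) by rewrite sqrtr_gt0 beta_gt0.
  have [f0 Ff0] := key (e * Num.sqrt (beta R n)) (mulr_gt0 e0 s0).
  exists f0; apply: filterS Ff0 => f /= h.
  by apply: le_lt_trans (pt f0 f n) _; rewrite ltr_pdivrMr.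
have cvRe n : cvg ((fun f : l2 R X => complex.Re (f n)) @ F).
  apply: cauchy_cvg; apply: cauchy_exP => e e0; have [f0 Ff0] := ptc n e e0.
  exists (complex.Re (f0 n)).
  suff : F ((fun f : l2 R X => complex.Re (f n)) @^-1`
            ball (complex.Re (f0 n)) e) by [].
  apply: filterS Ff0 => f /= h; rewrite -ball_normE /=; apply: le_lt_trans h.
  by apply: le_trans (Re_normc _); case: (f0 n) (f n) => [? ?] [? ?].
have cvIm n : cvg ((fun f : l2 R X => complex.Im (f n)) @ F).
  apply: cauchy_cvg; apply: cauchy_exP => e e0; have [f0 Ff0] := ptc n e e0.
  exists (complex.Im (f0 n)).
  suff : F ((fun f : l2 R X => complex.Im (f n)) @^-1`
            ball (complex.Im (f0 n)) e) by [].
  apply: filterS Ff0 => f /= h; rewrite -ball_normE /=; apply: le_lt_trans h.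
  by apply: le_trans (Im_normc _); case: (f0 n) (f n) => [? ?] [? ?].
pose g n : R[i] := lim ((fun f : l2 R X => complex.Re (f n)) @ F) +i*
                   lim ((fun f : l2 R X => complex.Im (f n)) @ F).
have fg e (f0 : l2 R X) : 0 < e ->
    F [set f | Num.sqrt (l2_nsq (f0 - f)) < e] ->
    forall k, psum (wsq ((f0 : T -> R[i]) - g)) k <= e ^+ 2.
  move=> e0 Ff0 k.
  have h : (fun f : l2 R X => psum (wsq (f0 - f : l2 R X)) k) @ F -->
           psum (wsq ((f0 : T -> R[i]) - g)) k.
    rewrite /psum; apply: cvg_big => [|n _]; first exact: add_continuous.
    have E (u v : T -> R[i]) : wsq (u - v) n =
      ((complex.Re (u n) - complex.Re (v n)) ^+ 2 +
       (complex.Im (u n) - complex.Im (v n)) ^+ 2) * beta R n.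
      rewrite /wsq sqr_normcE (_ : (u - v) n = u n - v n)//.
      by case: (u n) (v n) => [? ?] [? ?].
    rewrite E; under eq_fun do rewrite E.
    apply: cvgM; last exact: cvg_cst.
    apply: cvgD; rewrite expr2; under eq_fun do rewrite expr2.
      by apply: cvgM; (apply: cvgB; [exact: cvg_cst|exact: cvRe]).
    by apply: cvgM; (apply: cvgB; [exact: cvg_cst|exact: cvIm]).
  rewrite -(cvg_lim _ h)//; apply: limr_le; first by apply/cvg_ex; eexists; exact: h.
  apply: filterS Ff0 => f /= hf.
  apply: (@le_trans _ _ (l2_nsq (f0 - f))).
    exact: rsum_ge (@wsq_ge0 _ _ _) (l2_wsq (f0 - f)).
  rewrite -(sqr_sqrtr (l2_nsq_ge0 (f0 - f))) ler_pXn2r ?nnegrE ?sqrtr_ge0//.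
    exact: ltW.
  exact: ltW.
have gl2 : g \in l2_pred X.
  rewrite unfold_in; apply/asboolP; split.
    have [f0 Ff0] := key 1 ltr01.
    have -> : g = (f0 : T -> R[i]) + (-1) *: ((f0 : T -> R[i]) - g).
      by rewrite scaleN1r opprB addrC subrK.
    apply: square_summableD; first by apply/square_summableP; exact: l2_wsq.
    apply: square_summableZ; apply/square_summableP.
    exact: abs_boundedP (wsq_ge0 _) (fg _ _ ltr01 Ff0).
  move=> n Xn; rewrite /g.
  by congr Complex; apply/cvg_lim => //;
    under eq_fun do rewrite l2_supp//; exact: cvg_cst.
apply/cvg_ex; exists (L2 gl2); apply/cvgrPdist_lt => e /gt0_complexE [e0 ->].
have e20 : 0 < complex.Re e / 2 by rewrite divr_gt0.
have [f0 Ff0] := key _ e20.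
apply: filterS (Ff0) => f /= hf; rewrite l2_normE ltcR.
have -> : L2 gl2 - f = (-1) *: (f0 - L2 gl2) + (f0 - f).
  by rewrite scaleN1r opprB addrA subrK.
apply: le_lt_trans (sqrt_l2_nsqD _ _) _.
rewrite [ltRHS]splitr; apply: ler_ltD hf.
rewrite l2_nsqZ sqr_normcE /= oppr0 expr0n addr0 sqrrN expr1n mul1r.
apply: (@le_trans _ _ (Num.sqrt ((complex.Re e / 2) ^+ 2))); last first.
  by rewrite sqrtr_sqr ger0_norm// ltW.
rewrite ler_wsqrtr//; by apply: rsum_le; [exact: wsq_ge0|exact: fg].
Qed.

HB.instance Definition _ := Uniform_isComplete.Build (l2 R X) l2_complete.

End L2Complete.

Section Shifts.
Variables (R : realType) (d : nat).
Local Notation T := (multinom d).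

Lemma beta_le_shift (n : T) j : beta R n <= beta R (mnm_add n (mnm1 j)).
Proof.
have dn : mdeg (mnm_add n (mnm1 j)) = (mdeg n).+1.
  by rewrite mdegD mdeg1 addn1.
have pn : (\prod_(i < d) (mnm_add n (mnm1 j) i)`! =
           (n j).+1 * \prod_(i < d) (n i)`!)%N.
  rewrite (bigD1 j)//= [in RHS](bigD1 j)//= mnmDE mnm1E eqxx addn1 factS.
  rewrite mulnA; congr (_ * _)%N; apply: eq_bigr => i ij.
  by rewrite mnmDE mnm1E eq_sym (negbTE ij) addn0.
have p0 : 0 < (\prod_(i < d) (n i)`!)%:R :> R.
  by rewrite ltr0n prodn_gt0// => i; exact: fact_gt0.
have nj0 : 0 < (n j).+1%:R :> R by rewrite ltr0n.
have dj : (n j).+1%:R <= (mdeg n).+1%:R :> R.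
  by rewrite ler_nat ltnS mdegE (bigD1 j)//= leq_addr.
have f0 : 0 <= (mdeg n)`!%:R :> R by rewrite ler0n.
rewrite /beta dn pn factS !natrM ler_pdivrMr//.
rewrite invfM mulrA mulfVK ?gt_eqF// mulrAC ler_peMl//.
by rewrite ler_pdivlMr// mul1r.
Qed.

Lemma bshift_proof (j : 'I_d) (g : l2 R [set: T]) :
  (fun n => g (mnm_add n (mnm1 j))) \in l2_pred [set: T].
Proof.
rewrite unfold_in; apply/asboolP; split; last by move=> n /(_ I).
apply/square_summableP; have [M gM] := l2_wsq g.
apply: (abs_bounded_le
  (b := (wsq g \o (fun n => mnm_add n (mnm1 j))))); last first.
  move=> n; rewrite ger0_norm ?wsq_ge0// /wsq/= ler_wpM2l ?sqr_ge0//.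
  exact: beta_le_shift.
apply: (@abs_boundedP _ _ _ M) => [n|k]; first exact: wsq_ge0.
apply: le_trans (psum_reindex _ _ _ _) _; last 1 first.
- apply: le_trans (gM k.+1); apply: ler_psum => n; exact: ler_norm.
- by move=> m n /addIm.
- by move=> n; rewrite mdegD mdeg1 addn1.
- exact: wsq_ge0.
Qed.

Definition bshift (j : 'I_d) (g : l2 R [set: T]) : l2 R [set: T] :=
  L2 (bshift_proof j g).

Lemma bshift_linear j : linear (bshift j).
Proof. by move=> c f g; apply: l2P. Qed.

HB.instance Definition _ j :=
  GRing.isLinear.Build R[i] (l2 R [set: T]) (l2 R [set: T]) _ (bshift j)
    (bshift_linear j).

Variable X : set T.

Lemma l2_incl_proof (g : l2 R X) : (g : T -> R[i]) \in l2_pred [set: T].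
Proof.
rewrite unfold_in; apply/asboolP; split; last by move=> n /(_ I).
by apply/square_summableP; exact: l2_wsq.
Qed.

Definition l2_incl (g : l2 R X) : l2 R [set: T] := L2 (l2_incl_proof g).

(* [l2_proj X g] is the orthogonal projection of [g] onto l^2(X, beta), as an
   element of the subspace; it exists and is unique by [l2_projP] and
   [l2_projE], so the default value of [xget] is never used. *)
Definition l2_proj (g : l2 R [set: T]) : l2 R X :=
  xget 0 [set p : l2 R X |
    forall q : l2 R X, l2_dot (g - l2_incl p) (l2_incl q) = 0].

Lemma l2_restr_proof (g : l2 R [set: T]) :
  (fun n => if `[< X n >] then g n else 0) \in l2_pred X.
Proof.
rewrite unfold_in; apply/asboolP; split; last by move=> n /asboolPn/negbTE ->.
apply/square_summableP; apply: abs_bounded_le (l2_wsq g) _ => n.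
rewrite ger0_norm ?wsq_ge0// /wsq; case: ifPn => // _.
by rewrite normc0 expr0n mul0r; exact: wsq_ge0.
Qed.

Lemma l2_projP (g : l2 R [set: T]) (q : l2 R X) :
  l2_dot (g - l2_incl (l2_proj g)) (l2_incl q) = 0.
Proof.
rewrite /l2_proj; case: xgetP => [p _ //|/(_ (L2 (l2_restr_proof g)))].
case=> {}q; rewrite /l2_dot.
apply: csum_eq0 => n.
have -> : (g - l2_incl (L2 (l2_restr_proof g))) n =
    g n - (if `[< X n >] then g n else 0) by [].
case: ifPn => [_|/asboolPn Xn]; first by rewrite subrr !mul0r.
have h0 : l2_incl q n = 0 := l2_supp q Xn.
by rewrite h0 rmorph0 mulr0 mul0r.
Qed.

Lemma l2_projE (g : l2 R [set: T]) n :
  l2_proj g n = if `[< X n >] then g n else 0.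
Proof.
pose p := L2 (l2_restr_proof g); suff -> : l2_proj g = p by [].
apply/eqP; rewrite -subr_eq0; apply/eqP/l2_nsq_eq0.
set q := l2_proj g - p.
have e : l2_dot (l2_incl q) (l2_incl q) = 0.
  have eq : l2_incl q = (g - l2_incl p) - (g - l2_incl (l2_proj g)).
    apply: l2P => m.
    have -> : l2_incl q m = l2_proj g m - p m by [].
    have -> : (g - l2_incl p - (g - l2_incl (l2_proj g))) m =
      g m - p m - (g m - l2_proj g m) by [].
    by rewrite opprB [RHS]addrC addrA subrK.
  rewrite [X in l2_dot X _]eq l2_dotBl (l2_projP g q) subr0 /l2_dot.
  apply: csum_eq0 => m.
  have -> : (g - l2_incl p) m = g m - (if `[< X m >] then g m else 0) by [].
  case: ifPn => [_|/asboolPn Xm]; first by rewrite subrr !mul0r.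
  have h0 : l2_incl q m = 0 := l2_supp q Xm.
  by rewrite h0 rmorph0 mulr0 mul0r.
by move: e; rewrite l2_dotff => -[].
Qed.

Lemma l2_proj_linear : linear l2_proj.
Proof.
move=> c f g; apply: l2P => n.
apply: (etrans (l2_projE (c *: f + g) n)); symmetry.
apply: (etrans (f_equal2 (fun u v => c * u + v) (l2_projE f n) (l2_projE g n))).
case: ifP => _; first by [].
by rewrite mulr0 addr0.
Qed.

Definition compressed_shift (j : 'I_d) (g : l2 R X) : l2 R X :=
  l2_proj (bshift j (l2_incl g)).

Lemma compressed_shiftE j g n : compressed_shift j g n =
  if `[< X n >] then g (mnm_add n (mnm1 j)) else 0.
Proof. exact: l2_projE. Qed.

Lemma compressed_shift_linear j : linear (compressed_shift j).
Proof.
move=> c f g; apply: l2P => n.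
apply: (etrans (compressed_shiftE j (c *: f + g) n)); symmetry.
apply: (etrans (f_equal2 (fun u v => c * u + v) (compressed_shiftE j f n)
  (compressed_shiftE j g n))).
case: ifP => _; first by [].
by rewrite mulr0 addr0.
Qed.

HB.instance Definition _ j :=
  GRing.isLinear.Build R[i] (l2 R X) (l2 R X) _ (compressed_shift j)
    (compressed_shift_linear j).

Definition compressed_shift_tuple (j : 'I_d) : {linear l2 R X -> l2 R X} :=
  compressed_shift j.

Lemma l2_norm_dot (g : l2 R X) : `|g| ^+ 2 = l2_dot g g.
Proof.
by rewrite l2_normE l2_dotff -rmorphXn sqr_sqrtr// l2_nsq_ge0.
Qed.

Lemma l2_norm_esum (g : l2 R X) : ((complex.Re `|g| ^+ 2)%:E =
  \esum_(n in [set: T]) (normc (g n) ^+ 2 * beta R n)%:E)%E.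
Proof.
rewrite l2_normE /= sqr_sqrtr ?l2_nsq_ge0//.
by rewrite -esum_rsum//; [exact: wsq_ge0|exact: l2_wsq].
Qed.

End Shifts.

Section OperatorTuples.
Variables (R : realType) (d : nat) (H : normedModType R[i]).
Implicit Type A : 'I_d -> {linear H -> H}.

Definition bounded_operator (T : {linear H -> H}) : Prop :=
  exists M : R, forall h, `|T h| <= M%:C * `|h|.

(* A_1^{n_1} o ... o A_d^{n_d} *)
Definition monomial_op A (n : multinom d) : H -> H :=
  \big[comp/idfun]_(i < d) iter (n i) (A i).

Definition vanishing_set A : set (multinom d) :=
  [set n | forall h, monomial_op A n h = 0].

Definition poly_op (Q : mpoly d R[i]) A (h : H) : H :=
  \sum_(n <- msupp Q) mcoeff n Q *: monomial_op A n h.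

(* Valued in the extended reals, so that no boundedness has to be assumed. *)
Definition opnorm (T : H -> H) : \bar R :=
  ereal_sup [set (complex.Re `|T h|)%:E | h in [set h : H | `|h| <= 1]].

Definition commuting_contraction A : Prop :=
  [/\ forall j, bounded_operator (A j),
      forall i j h, A i (A j h) = A j (A i h)
    & forall h, \sum_(j < d) `|A j h| ^+ 2 <= `|h| ^+ 2].

End OperatorTuples.

(* Main.v *)
Require Import Defs.
From HB Require Import structures.
From mathcomp Require Import all_boot all_order all_algebra sesquilinear.
From mathcomp Require Import complex.
From mathcomp Require Import -(notations) mpoly.
From mathcomp Require Import all_classical all_reals all_analysis.
From mathcomp Require Import ring.

Import Order.TTheory GRing.Theory Num.Theory.
Import numFieldNormedType.Exports.

Local Open Scope classical_set_scope.
Local Open Scope ring_scope.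

(** The vanishing set N is closed under adding multi-indices because the A_j
commute, so X is closed downwards and the compression changes nothing:
(B^X_j g)(n) = g(n + e_j) for every n. Hence (B^X)^n g (m) = g(n + m), which is
identically zero if n is in N, and nonzero at m = 0 for g the indicator of n if n
is in X. The contraction inequality follows from
beta(n) = beta(n + e_j) (n_j + 1) / (|n| + 1): after the shift of index, the
weights m_j / |m| in front of |g(m)|^2 beta(m) add up to at most 1. *)

Lemma iter_comm {T : Type} (f g : T -> T) k h :
  (forall x, f (g x) = g (f x)) -> iter k f (g h) = g (iter k f h).
Proof. by move=> fg; elim: k => //= k ->. Qed.

Section MonomialOp.
Context {R : realType} {d : nat} {H : normedModType R[i]}.
Variable A : 'I_d -> {linear H -> H}.

Lemma monomial_op0r n : monomial_op A n 0 = 0.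
Proof.
rewrite /monomial_op; elim: (index_enum _) => [|i s IH]; first by rewrite big_nil.
by rewrite big_cons /= IH; elim: (n i) => //= k ->; rewrite linear0.
Qed.

Hypothesis A_comm : forall i j h, A i (A j h) = A j (A i h).

(** By induction on the list of indices: the block [iter (n i) (A i)] has to move past the
    [m]-powers of the remaining operators, which is where commutativity enters. *)
Lemma monomial_opD m n h :
  monomial_op A (mnm_add m n) h = monomial_op A m (monomial_op A n h).
Proof.
rewrite /monomial_op; elim: (index_enum _) h => [|i s IH] h; first by rewrite !big_nil.
rewrite !big_cons /= IH mnmDE iterD; congr iter.
have comm (x : H) : A i ((\big[comp/idfun]_(j <- s) iter (m j) (A j)) x) =
    (\big[comp/idfun]_(j <- s) iter (m j) (A j)) (A i x).
  elim: (s) x => [|j t IHt] x; first by rewrite !big_nil.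
  by rewrite !big_cons /= -IHt (iter_comm _ (A i)).
by rewrite iter_comm.
Qed.

Lemma vanishing_setD m n : vanishing_set A n -> vanishing_set A (mnm_add m n).
Proof. by move=> An h; rewrite monomial_opD An monomial_op0r. Qed.

End MonomialOp.

(** Follows from |n + e_j|! = (|n| + 1) |n|! and (n + e_j)! = (n_j + 1) n!. The factor is written in
    terms of the shifted index only, ready for reindexing. *)
Lemma beta_shift (R : realType) (d : nat) (n : multinom d) (j : 'I_d) :
  beta R n = beta R (mnm_add n (mnm1 j)) *
    (mnm_add n (mnm1 j) j)%:R / (mdeg (mnm_add n (mnm1 j)))%:R.
Proof.
have pn : (\prod_(i < d) (mnm_add n (mnm1 j) i)`! =
           (n j).+1 * \prod_(i < d) (n i)`!)%N.
  rewrite (bigD1 j)//= [in RHS](bigD1 j)//= mnmDE mnm1E eqxx addn1 factS.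
  rewrite mulnA; congr (_ * _)%N; apply: eq_bigr => i ij.
  by rewrite mnmDE mnm1E eq_sym (negbTE ij) addn0.
have p0 : (\prod_(i < d) (n i)`!)%:R != 0 :> R.
  by rewrite pnatr_eq0 -lt0n prodn_gt0// => i; exact: fact_gt0.
rewrite /beta pn mdegD mdeg1 mnmDE mnm1E eqxx !addn1 factS !natrM.
by field; rewrite p0 !nat1r !pnatr_eq0.
Qed.

Lemma psum_sum (R : realType) (d : nat) I (s : seq I) (a : I -> multinom d -> R) k :
  psum (fun n => \sum_(i <- s) a i n) k = \sum_(i <- s) psum (a i) k.
Proof. exact: exchange_big. Qed.

(** Finite sums commute with the limit in [k], so an inequality between sums of series may be
    checked on truncations of a common degree. *)
Lemma rsum_sum_le (R : realType) (d : nat) I (s : seq I)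
    (a : I -> multinom d -> R) (M : R) :
  (forall i, abs_bounded (a i)) ->
  (forall k, \sum_(i <- s) psum (a i) k <= M) -> \sum_(i <- s) rsum (a i) <= M.
Proof.
move=> ha aM.
have cv : (fun k => \sum_(i <- s) psum (a i) k) @ \oo --> \sum_(i <- s) rsum (a i).
  apply: cvg_big => [|i _]; first exact: add_continuous.
  exact: cvg_psum.
rewrite -(cvg_lim _ cv)//; apply: limr_le; first by apply/cvg_ex; eexists; exact: cv.
exact: nearW.
Qed.

Section CompressedShift.
Context {R : realType} {d : nat} {X : set (multinom d)}.
Implicit Types (g : l2 R X) (m n : multinom d).

Lemma l2_normsqE g : `|g| ^+ 2 = (l2_nsq g)%:C%C.
Proof. by rewrite l2_norm_dot l2_dotff. Qed.

Lemma l2_nsq_compressed_shift g :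
  \sum_(j < d) l2_nsq (compressed_shift j g) <= l2_nsq g.
Proof.
(* [F j] is the share m_j / |m| of the term of [g] at m; at m = n + e_j it dominates the term of the
   [j]-th shift at n. *)
pose F (j : 'I_d) n : R := wsq g n * ((n j)%:R / (mdeg n)%:R).
have F0 j n : 0 <= F j n by rewrite mulr_ge0 ?wsq_ge0// divr_ge0.
apply: rsum_sum_le => [j|k]; first exact: l2_wsq.
(* The truncation grows to [k.+1] because adding e_j raises the degree by one. *)
apply: (@le_trans _ _ (\sum_(j < d) psum (F j) k.+1)).
  apply: ler_sum => j _.
  apply: (@le_trans _ _ (psum (F j \o (fun n => mnm_add n (mnm1 j))) k)).
    apply: ler_psum => n; rewrite /F /= /wsq compressed_shiftE.
    rewrite -[leRHS]mulrA [X in _ <= _ * X]mulrA -beta_shift.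
    apply: ler_wpM2r; first by rewrite ltW ?beta_gt0.
    case: ifP => // _.
    by rewrite Normc.normc0 expr0n sqr_ge0.
  apply: psum_reindex => //; first by move=> m n /addIm.
  by move=> n; rewrite mdegD mdeg1 addn1.
rewrite -psum_sum.
apply: le_trans (rsum_ge k.+1 (wsq_ge0 g) (l2_wsq g)).
apply: ler_psum => n; rewrite -mulr_sumr -mulr_suml -natr_sum -mdegE.
rewrite ler_piMr ?wsq_ge0//.
(* For n = 0 the total weight 0 / 0 is 0 by convention; otherwise it is exactly 1. *)
by have [->|n0] := eqVneq (mdeg n) 0%N; rewrite ?mul0r// divff ?pnatr_eq0.
Qed.

Lemma sum_compressed_shift_sqr_le g :
  \sum_(j < d) `|compressed_shift j g| ^+ 2 <= `|g| ^+ 2.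
Proof.
under eq_bigr do rewrite l2_normsqE.
by rewrite l2_normsqE -rmorph_sum lecR l2_nsq_compressed_shift.
Qed.

Lemma compressed_shift_bounded j : bounded_operator (compressed_shift_tuple R X j).
Proof.
exists 1 => g; rewrite mul1r -(@ler_pXn2r _ 2%N)// ?nnegrE//.
apply: le_trans (sum_compressed_shift_sqr_le g).
by rewrite (bigD1 j)//= lerDl sumr_ge0// => i _; rewrite exprn_ge0.
Qed.

(** This indicator is the test vector on which the monomial of exponent [n] will not vanish; each
    partial sum of its squared norm is [beta R n] or 0. *)
Lemma l2_delta_proof n : X n -> (fun m => (m == n)%:R : R[i]) \in l2_pred X.
Proof.
move=> Xn; rewrite unfold_in; apply/asboolP; split; last first.
  by move=> m Xm; case: eqP Xm => // ->.
apply/square_summableP; apply: (@abs_boundedP _ _ _ (beta R n)) => [m|k].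
  exact: wsq_ge0.
rewrite /psum (eq_bigr (fun m : bmultinom d k => if val m == n then beta R n else 0)).
  rewrite -big_mkcond /=; have [nk|kn] := ltnP (mdeg n) k.
    by rewrite (big_pred1 (BMultinom nk)).
  rewrite big_pred0; first by rewrite ltW ?beta_gt0.
  move=> -[m /= mk]; apply/negbTE.
  by apply: contraTneq mk => ->; rewrite -leqNgt.
move=> m _; rewrite /wsq; case: eqP => [->|_].
  by rewrite Normc.normc1 expr1n mul1r.
by rewrite Normc.normc0 expr0n mul0r.
Qed.

Hypothesis X_down : forall m n, X (mnm_add m n) -> X n.

(** Outside [X] the projection gives 0, and so does [g] at the shifted index, which is outside [X]
    as well. *)
Lemma compressed_shift_downE j g n :
  compressed_shift j g n = g (mnm_add (mnm1 j) n).
Proof.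
rewrite compressed_shiftE; case: ifPn => [_|/asboolPn Xn].
  by rewrite addmC.
by rewrite l2_supp// => /X_down.
Qed.

Lemma compressed_shiftC i j g :
  compressed_shift i (compressed_shift j g) =
  compressed_shift j (compressed_shift i g).
Proof.
have E a b n : compressed_shift a (compressed_shift b g) n =
    g (mnm_add (mnm1 b) (mnm_add (mnm1 a) n)).
  exact: etrans (compressed_shift_downE _ _ _) (compressed_shift_downE _ _ _).
apply: l2P => n; apply: etrans (E i j n) _.
rewrite addmA (addmC (mnm1 j)) -addmA; exact: esym (E j i n).
Qed.

Lemma monomial_op_compressed_shiftE n g m :
  monomial_op (compressed_shift_tuple R X) n g m = g (mnm_add n m).
Proof.
have iterE j k f q :
    iter k (compressed_shift_tuple R X j) f q = f (mnm_add (mnm_muln (mnm1 j) k) q).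
  elim: k f q => [|k IH] f q; first by rewrite mulm0n add0m.
  by rewrite iterSr IH compressed_shift_downE addmA -mulmS.
(* Writing [n] as the sum of the n_i e_i lets the product of powers and the shift of index unfold
   along the same list. *)
rewrite [in RHS](multinomUE_id n) /monomial_op.
elim: (index_enum _) m => [|i s IH] m; first by rewrite !big_nil add0m.
by rewrite !big_cons /= iterE IH addmA [mnm_add (\big[_/_]_(_ <- _) _) _]addmC.
Qed.

Lemma vanishing_set_compressed_shift :
  vanishing_set (compressed_shift_tuple R X) = ~` X.
Proof.
apply/seteqP; split=> [n Bn Xn|n Xn g].
  (* Evaluated at 0, the image of the indicator of [n] is its value at [n], namely 1. *)
  have := congr1 (fun g : l2 R X => g mnm0) (Bn (L2 (l2_delta_proof _ Xn))).
  rewrite monomial_op_compressed_shiftE /= addm0 eqxx => /eqP.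
  by rewrite oner_eq0.
apply: l2P => m; rewrite monomial_op_compressed_shiftE l2_supp//.
by rewrite addmC => /X_down.
Qed.

End CompressedShift.

Theorem mainTheorem2 (R : realType) (d : nat) (d_ge2 : (2 <= d)%N)
    (H : completeNormedModType R[i]) (dotH : {dot H for Num.conj})
    (normH : forall h : H, `|h| ^+ 2 = dotH h h)
    (A : 'I_d -> {linear H -> H})
    (A_bounded : forall j, bounded_operator (A j))
    (A_comm : forall i j h, A i (A j h) = A j (A i h))
    (A_contr : forall h, \sum_(j < d) `|A j h| ^+ 2 <= `|h| ^+ 2) :
  let N : set (multinom d) := vanishing_set A in
  let X : set (multinom d) := ~` N in
  let B : 'I_d -> {linear l2 R X -> l2 R X} := compressed_shift_tuple R X in
  [/\ forall j, bounded_operator (B j),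
      forall i j g, B i (B j g) = B j (B i g),
      forall g, \sum_(j < d) `|B j g| ^+ 2 <= `|g| ^+ 2,
      vanishing_set B = N
    & forall (Q : mpoly d R[i]) (c : \bar R),
        (forall (K : completeNormedModType R[i]) (dotK : {dot K for Num.conj})
            (A' : 'I_d -> {linear K -> K}),
          (forall h : K, `|h| ^+ 2 = dotK h h) ->
          commuting_contraction A' -> vanishing_set A' = N ->
          (opnorm (poly_op Q A') <= c)%E) ->
        (opnorm (poly_op Q B) <= c)%E].
Proof.
move=> N X B.
have X_down m n : X (mnm_add m n) -> X n.
  by move=> Xmn Nn; apply: Xmn; exact: vanishing_setD.
have BC i j g : B i (B j g) = B j (B i g) := compressed_shiftC X_down i j g.
have Bb j : bounded_operator (B j) := compressed_shift_bounded j.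
have Bcontr g : \sum_(j < d) `|B j g| ^+ 2 <= `|g| ^+ 2 := sum_compressed_shift_sqr_le g.
have BN : vanishing_set B = N.
  by rewrite (vanishing_set_compressed_shift X_down) setCK.
(* Optimality: the assumed bound is applied to [B] itself, with K = [l2 R X], an admissible tuple by
   the facts just collected. *)
split=> // Q c; apply => //.
exact: l2_norm_dot.
Qed.
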